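(* Let $\mathbf{G}$ be a finite abelian group of size $N$ and $w : \mathbb{N} \rightarrow \mathbb{R}$ be a growing function that tends to infinity. Let $A \subset \mathbf{G}$ be a random subset obtained by putting every element of $\mathbf{G}$ into $A$ independently with probability $\frac{1}{2}$. Then with probability $1 - o(1)$, for all sets $X, Y \subset \mathbf{G}$ such that $$|X| \geq w(|\mathbf{G}|) \log |\mathbf{G}| (\log \log |\mathbf{G}|)^2, \quad |Y| \geq w(|\mathbf{G}|) \log |\mathbf{G}| (\log \log |\mathbf{G}|)^{10},$$ one has $$\sum_{x \in X} \sum_{y \in Y} A(x + y) = \frac{1}{2} |X| |Y| + o(|X| |Y|) \quad (|\mathbf{G}| \rightarrow \infty),$$ where the rate of convergence implied by the $o$-notation depends only on $w$.
   Context: For a set $A \subset \mathbf{G}$, the same letter $A$ also denotes its characteristic function $A : \mathbf{G} \rightarrow \{0,1\}$, so $A(x+y)=1$ iff $x+y\in A$. *)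

(* Defs.v *)
From HB Require Import structures.
From mathcomp Require Import all_boot all_order all_algebra.
From mathcomp Require Import all_classical all_reals all_analysis.
Set Implicit Arguments.
Unset Strict Implicit.
Unset Printing Implicit Defensive.
Import Order.TTheory GRing.Theory Num.Theory.
Import numFieldNormedType.Exports.
Local Open Scope classical_set_scope.
Local Open Scope ring_scope.

Definition mutually_independent_events (d : measure_display)
    (T : measurableType d) (R : realType) (P : probability T R)
    (I : finType) (E : I -> set T) : Prop :=
  forall J : {set I},
    P (\bigcap_(i in [set` J]) E i) = (\prod_(i in J) P (E i))%E.

(* A random subset of G, seen as a set-valued map on the sample space: each
   point is in A with probability 1/2, independently of the others. *)
Definition half_random_subset (d : measure_display) (T : measurableType d)
    (R : realType) (P : probability T R) (G : finType)
    (A : T -> {set G}) : Prop :=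
  [/\ forall x : G, measurable [set t | x \in A t],
      forall x : G, P [set t | x \in A t] = (2^-1)%:E
    & mutually_independent_events P (fun x : G => [set t | x \in A t])].

(* Main.v *)
Require Import Defs.
From HB Require Import structures.
From mathcomp Require Import all_boot all_order all_algebra.
From mathcomp Require Import all_classical all_reals all_analysis.
From mathcomp Require Import fintype finset zify ring lra.
Set Implicit Arguments.
Unset Strict Implicit.
Unset Printing Implicit Defensive.
Import Order.TTheory GRing.Theory Num.Theory.
Import numFieldNormedType.Exports.

(** By averaging it suffices to treat sets with |X| = m and |Y| = n exactly,
where m ~ L (ln L)^2, n ~ L (ln L)^10, and an error eps m n with eps fixed.
A union bound over all pairs (X, Y) is hopeless when the additive energy of
(X, Y) is large, so X is peeled at dyadic scales q = 2^j: let C_j be the largest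
V in X such that every x in V satisfies q #{(x', y, y') : x + y = x' + y'} >= n^2,
with x' in V and y, y' in Y.  One of the layers W = C_(j+1) \ C_j carries a
proportional part of the bias.

On the one hand no subset of W is that dense at scale 2^j, so (W, Y) has energy
O(n^2 |W| / q) with q = 2^(j+1); replacing Y by q random elements of Y keeps the
bias and makes the energy O(q |W|), so that a Chernoff bound gives a deviation
probability exp(-c eps^2 q m / ln L).  On the other hand, for a suitable set S
of O(q ln m) differences of elements of Y the graph on C_(j+1) joining x to x +- d,
d in S, has only O(q) components, because a random difference merges a given
small component with probability at least 1/(2q).  Hence C_(j+1) can be
described by O(q ln m) elements of the group and O(ln n) further bits per element
of C_(j+1), which the deviation probability beats as soon as
m >> L (ln L)^2 and n / m >> (ln L)^2, since a nonempty layer has q >= n / m. *)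

(** * Cores of a weighted graph and the energy of the layers between them *)

Section Core.
Variables (T : finType) (r : T -> T -> nat).
Implicit Types U V W X : {set T}.

Definition wdeg U x := \sum_(y in U) r x y.

Lemma wdegS U V x : U \subset V -> wdeg U x <= wdeg V x.
Proof.
move=> UV; rewrite /wdeg [leqRHS](big_setID U) /= (setIidPr UV).
exact: leq_addr.
Qed.

(** Induction on [#|W|]: deleting a vertex [x] of small degree removes its row and its column, each
    of weight at most [wdeg W x], hence the factor 2. *)
Lemma energy_degenerate W D q (r_sym : forall x y, r x y = r y x) :
  (forall U, U \subset W -> U != set0 -> exists2 x, x \in U & q * wdeg U x <= D) ->
  q * \sum_(x in W) wdeg W x <= 2 * D * #|W|.
Proof.
have [k] := ubnP #|W|; elim: k W => // k IHk W; rewrite ltnS => Wk degW.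
have [->|W0] := eqVneq W set0; first by rewrite big_set0 muln0.
have [x xW xD] := degW W (subxx _) W0.
have IH : q * \sum_(y in W :\ x) wdeg (W :\ x) y <= 2 * D * #|W :\ x|.
  apply: IHk => [|U UW U0]; first by move: Wk; rewrite (cardsD1 x W) xW.
  by apply: degW => //; apply: (subset_trans UW); apply: subsetDl.
have degE y : wdeg W y = r y x + wdeg (W :\ x) y.
  by rewrite /wdeg (big_setD1 x).
have EW : \sum_(y in W) wdeg W y
    = wdeg W x + (wdeg (W :\ x) x + \sum_(y in W :\ x) wdeg (W :\ x) y).
  rewrite (big_setD1 x) //= (eq_bigr _ (fun y _ => degE y)) big_split /=.
  by congr (_ + (_ + _)); apply: eq_bigr => y _; apply: r_sym.
have := degE x; rewrite EW (cardsD1 x W) xW; move: xD IH.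
set a := wdeg W x; set b := wdeg _ x; set c := \sum_(_ in _) _.
set e := #|_| => h1 h2 h3.
have : q * b <= q * a by rewrite leq_mul2l h3 leq_addl orbT.
nia.
Qed.

(** Since [wdeg] is monotone in the set, the union of all admissible [V] is itself admissible, hence
    the largest one. *)
Definition core D q X : {set T} :=
  \bigcup_(V : {set T} | (V \subset X) && [forall x in V, D <= q * wdeg V x]) V.

Lemma core_sub D q X : core D q X \subset X.
Proof. by apply/bigcupsP => V /andP[]. Qed.

Lemma core_max D q X V : V \subset X -> {in V, forall x, D <= q * wdeg V x} ->
  V \subset core D q X.
Proof.
move=> VX VD; apply: (bigcup_sup V) => //.
by rewrite VX; apply/forall_inP.
Qed.

Lemma core_wdeg D q X : {in core D q X, forall x, D <= q * wdeg (core D q X) x}.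
Proof.
move=> x /bigcupP[V /andP[VX /forall_inP VD] xV].
apply: (leq_trans (VD _ xV)); rewrite leq_mul2l wdegS ?orbT //.
exact: core_max.
Qed.

Lemma core_leq D p q X : p <= q -> core D p X \subset core D q X.
Proof.
move=> pq; apply: core_max (core_sub _ _ _) _ => x /core_wdeg h.
by apply: (leq_trans h); rewrite leq_mul2r pq orbT.
Qed.

(** If all vertices of a nonempty part [U] of the layer had degree above the threshold at scale [p],
    maximality would place [U] inside [core D p X], which is disjoint from the layer. So the layer
    is degenerate at scale [p]. *)
Lemma core_diff_energy D p q X (r_sym : forall x y, r x y = r y x) :
  p * \sum_(x in core D q X :\: core D p X) wdeg (core D q X :\: core D p X) x
    <= 2 * D * #|core D q X :\: core D p X|.
Proof.
set W := _ :\: _; apply: energy_degenerate => // U UW U0.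
apply/exists_inP; apply: contraNT U0 => /exists_inPn Udeg.
have UX : U \subset X.
  by rewrite (subset_trans UW) // (subset_trans (subsetDl _ _)) // core_sub.
have Ucore : U \subset core D p X.
  by apply: core_max => // x xU; move: (Udeg x xU); rewrite -ltnNge => /ltnW.
rewrite -subset0; apply/subsetP => x xU; move/subsetP: UW => /(_ x xU).
by rewrite inE (subsetP Ucore).
Qed.

End Core.

(** * Counting connected components through canonical roots *)

Section Components.
Variables (T : finType).
Implicit Types (e : rel T) (V B : {set T}).

Definition comp_roots e V : {set T} := [set fingraph.root e x | x in V].

Lemma comp_roots_le e V B : connect_sym e ->
  {in V, forall x, exists2 b, b \in B & connect e x b} ->
  #|comp_roots e V| <= #|B|.
Proof.
move=> se VB; apply: (leq_trans _ (leq_imset_card (fingraph.root e) [in B])).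
apply: subset_leq_card; apply/subsetP => _ /imsetP[x xV ->].
have [b bB /(fingraph.rootP se) ->] := VB _ xV; exact: imset_f.
Qed.

(* Following [phi] strictly downwards for an arbitrary linear order must leave
   the set of merged roots, hence half of [Q] can be dropped at once. *)
Lemma comp_roots_merge e e' V (Q : {set T}) (phi : T -> T) :
  connect_sym e -> connect_sym e' -> subrel e e' ->
  Q \subset comp_roots e V ->
  {in Q, forall b, [/\ phi b \in comp_roots e V, phi b != b
                     & connect e' b (phi b)]} ->
  2 * #|comp_roots e' V| + #|Q| <= 2 * #|comp_roots e V|.
Proof.
move=> se se' ee' QR Qphi; set R := comp_roots e V.
(* The order enters only through its induction principle on indices below [#|T|], so that one
   argument serves for both the increasing and the decreasing order. *)
have half (lt : rel nat) : (forall P : pred nat,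
    (forall k, (forall j, j < #|T| -> lt j k -> P j) -> P k) ->
     forall k, k < #|T| -> P k) ->
    #|comp_roots e' V| + #|[set b in Q | lt (enum_rank (phi b)) (enum_rank b)]|
      <= #|R|.
  move=> ltind; set Q' := finset _.
  have Q'R : Q' \subset R by apply: subset_trans QR; apply/subsetP => b /[!inE] /andP[].
  suff : #|comp_roots e' V| <= #|R :\: Q'|.
    by rewrite cardsD (setIidPr Q'R); move: (subset_leq_card Q'R); lia.
  have key k : k < #|T| -> [forall b in R, (enum_rank b == k :> nat) ==>
      [exists c in R :\: Q', connect e' b c]].
    move: k; apply: ltind => k IH; apply/forall_inP => b bR.
    apply/implyP => /eqP bk; apply/exists_inP.
    have [bQ'|bQ'] := boolP (b \in Q'); last first.
      by exists b; rewrite // inE bQ'.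
    have /[!inE] /andP[bQ bphi] := bQ'.
    have [phiR _ cphi] := Qphi _ bQ.
    have := IH (enum_rank (phi b)) (ltn_ord _); rewrite -bk => /(_ bphi).
    move=> /forall_inP /(_ _ phiR) /[!eqxx] /exists_inP[c cR cc].
    by exists c => //; apply: connect_trans cphi cc.
  apply: comp_roots_le => // x xV.
  have rR : fingraph.root e x \in R by apply: imset_f.
  have := key (enum_rank (fingraph.root e x)) (ltn_ord _).
  move=> /forall_inP /(_ _ rR) /[!eqxx] /exists_inP[c cR cc]; exists c => //.
  apply: connect_trans cc; apply: (connect_sub _ (connect_root e x)).
  by move=> u v /ee'; apply: connect1.
have h1 := half ltn _; have h2 := half (fun a b => ltn b a) _.
have {h1} := h1 _; have {h2} := h2 _.
set Q2 := [set b in Q | _]; set Q1 := [set b in Q | _].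
(* Since [phi b != b], each [b] in [Q] goes strictly down for one of the two orders; adding the two
   bounds gives the factor 2. *)
have : #|Q| <= #|Q1| + #|Q2|.
  rewrite -cardsUI; apply: leq_trans (leq_addr _ _); apply: subset_leq_card.
  apply/subsetP => b bQ; rewrite !inE bQ /=; have [_ + _] := Qphi _ bQ.
  rewrite -(inj_eq enum_rank_inj) -(inj_eq val_inj) /=; lia.
move=> hQ h2 h1.
suff: #|comp_roots e' V| + #|Q1| <= #|R| /\ #|comp_roots e' V| + #|Q2| <= #|R| by lia.
split.
  apply: h1 => P Pind k; elim/ltn_ind: k => k IH kT; apply: Pind => j jT jk.
  exact: IH.
apply: h2 => P Pind k kT; have [d] := ubnP (#|T| - k).
elim: d k kT => // d IH k kT dk; apply: Pind => j jT jk; apply: IH => //.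
by move: jk dk jT kT => /=; lia.
Qed.

End Components.

(** * Additive representation counts and difference graphs *)

Section Growth.
Variable G : finZmodType.
Implicit Types S U V Y D : {set G}.

(** A symmetric weight whose sum over pairs from [W] is the additive energy of [W] and [Y]. *)
Definition rep Y (x x' : G) : nat :=
  \sum_(y in Y) \sum_(y' in Y) (x + y == x' + y')%R.

Lemma repC Y x x' : rep Y x x' = rep Y x' x.
Proof.
rewrite /rep exchange_big; apply: eq_bigr => y _; apply: eq_bigr => y' _.
by rewrite eq_sym.
Qed.

Lemma sum_nat_eq_mem (A : {set G}) (a : G) :
  \sum_(x in A) (a == x) = (a \in A).
Proof.
rewrite big_mkcond (bigD1 a) //= eqxx big1 ?addn0; first by case: (a \in A).
by move=> x /negPf; rewrite eq_sym => ->; case: ifP.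
Qed.

(** In this form a large [wdeg] says that adding a random difference of two elements of [Y] to [x]
    often lands in [U]. *)
Lemma wdeg_rep Y U x :
  wdeg (rep Y) U x = \sum_(y in Y) \sum_(y' in Y) (x + (y - y') \in U)%R.
Proof.
rewrite /wdeg /rep exchange_big; apply: eq_bigr => y _.
rewrite exchange_big; apply: eq_bigr => y' _ /=.
rewrite -sum_nat_eq_mem; apply: eq_bigr => x' _.
by rewrite addrA subr_eq.
Qed.

Lemma sum_mem_translate Y U (a : G) : \sum_(y in Y) ((a - y)%R \in U) <= #|U|.
Proof.
rewrite -sum1_card big_mkcond [leqRHS]big_mkcond /=.
rewrite [leqRHS](reindex_inj (inv_inj (subKr a))) /=.
by apply: leq_sum => y _; do 2!case: ifP.
Qed.

Lemma wdeg_rep_le Y U x : wdeg (rep Y) U x <= #|Y| * #|U|.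
Proof.
rewrite wdeg_rep -sum_nat_const; apply: leq_sum => y _.
under eq_bigr do rewrite addrA; exact: sum_mem_translate.
Qed.

Lemma wdeg_rep_ge Y U x : x \in U -> #|Y| <= wdeg (rep Y) U x.
Proof.
move=> xU; rewrite wdeg_rep -sum1_card; apply: leq_sum => y yY.
by rewrite (bigD1 y) //= subrr addr0 xU.
Qed.

(** The Cayley graph of the differences in [S] and their negatives, induced on [V]. *)
Definition edge S V : rel G :=
  [rel x y | [&& x \in V, y \in V & (x - y \in S)%R || (y - x \in S)%R]].

Lemma edge_connect_sym S V : connect_sym (edge S V).
Proof.
by apply: sym_connect_sym => x y; rewrite /edge /= andbCA orbC.
Qed.

Lemma edge_connect_mem S V x y : connect (edge S V) x y -> x \in V -> y \in V.
Proof.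
move=> /connectP[p + ->]; elim: p x => //= z p IH x /andP[/and3P[_ zV _] zp] _.
exact: IH.
Qed.

Lemma comp_roots_sub S V : comp_roots (edge S V) V \subset V.
Proof.
apply/subsetP => _ /imsetP[x xV ->].
exact: edge_connect_mem (connect_root _ _) xV.
Qed.

Lemma comp_rootsP S V b :
  b \in comp_roots (edge S V) V -> fingraph.root (edge S V) b = b.
Proof. by case/imsetP => x _ ->; rewrite root_root //; apply: edge_connect_sym. Qed.

Definition comp S V b : {set G} := [set z in V | connect (edge S V) b z].

Lemma sum_comp_le S V (A : {set G}) : A \subset comp_roots (edge S V) V ->
  \sum_(b in A) #|comp S V b| <= #|V|.
Proof.
move=> AR; rewrite -sum1_card.
rewrite [leqRHS](partition_big (fingraph.root (edge S V)) (mem (comp_roots (edge S V) V)))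
  /=; last first.
  move=> x xV. exact: imset_f.
rewrite big_mkcond [leqRHS]big_mkcond; apply: leq_sum => b _ /=.
case: ifP => // bA; have bR := subsetP AR _ bA; rewrite bR.
rewrite -sum1_card big_mkcond [leqRHS]big_mkcond /=; apply: leq_sum => z _.
rewrite inE; case: ifP => // /andP[-> /(fingraph.rootP (@edge_connect_sym S V)) <-].
by rewrite comp_rootsP // eqxx.
Qed.

(* With c, c' components before and after adding [d], and b = 2 q #|V| / #|Y|, this
   says c' - b <= (1 - 1/(4q)) (c - b), cleared of denominators. *)
Lemma merge_step S V Y q : 0 < #|Y| ->
  {in V, forall x, #|Y| ^ 2 <= q * wdeg (rep Y) V x} ->
  exists d, (4 * q * #|comp_roots (edge (d |: S) V) V|
             + #|comp_roots (edge S V) V|) * #|Y|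
    <= 4 * q * #|comp_roots (edge S V) V| * #|Y| + 2 * q * #|V|.
Proof.
move=> Y0 Vdeg; set R := comp_roots (edge S V) V; set n := #|Y|.
(* Small components have fewer than [n / (2q)] elements; the others are disjoint in [V], so there
   are at most [2q #|V| / n] of them. *)
pose small := [set b in R | 2 * q * #|comp S V b| < n].
pose hit (b : G) d := (b + d)%R \in V :\: comp S V b.
have big_le : #|R :\: small| * n <= 2 * q * #|V|.
  have : \sum_(b in R :\: small) #|comp S V b| <= #|V|.
    by apply: sum_comp_le; apply: subsetDl.
  move=> /(leq_mul (leqnn (2 * q))); apply: leq_trans.
  rewrite -sum_nat_const big_distrr /=; apply: leq_sum => b.
  by rewrite !inE => /andP[+ bR]; rewrite bR -leqNgt.
(* At least [n^2 / q] pairs [(y, y')] move [b] into [V], and fewer than [n^2 / (2q)] keep it in its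
   own small component. *)
have hits b : b \in small ->
    n ^ 2 <= 2 * q * \sum_(y in Y) \sum_(y' in Y) hit b (y - y')%R.
  rewrite inE => /andP[bR bs].
  have bV := subsetP (comp_roots_sub S V) _ bR.
  have := Vdeg _ bV; have := wdeg_rep_le Y (comp S V b) b.
  have -> : wdeg (rep Y) V b = wdeg (rep Y) (comp S V b) b +
      \sum_(y in Y) \sum_(y' in Y) hit b (y - y')%R.
    rewrite !wdeg_rep -big_split; apply: eq_bigr => y _.
    rewrite -big_split; apply: eq_bigr => y' _ /=; rewrite /hit !inE.
    by case: (_ \in V); case: connect.
  rewrite -/n; move: bs; set c := #|comp _ _ _|; set a := wdeg _ _ _.
  set e := \sum_(_ in _) _; nia.
(* Double counting over pairs: some difference moves at least a proportion [1 / (2q)] of the small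
   roots to another component. *)
have [d dhit] : exists d, #|small| <= 2 * q * #|[set b in small | hit b d]|.
  have [[y y'] /= _ hyy] : exists2 p : G * G, true &
      #|small| <= 2 * q * #|[set b in small | hit b (p.1 - p.2)%R]|;
      last by exists (y - y')%R.
  apply/exists_inP; apply: contraT => /exists_inPn none.
  have : \sum_(b in small) n ^ 2 <=
      \sum_(y in Y) \sum_(y' in Y) 2 * q * #|[set b in small | hit b (y - y')%R]|.
    apply: (leq_trans (leq_sum _ hits)).
    rewrite -big_distrr exchange_big /= big_distrr; apply: leq_sum => y _ /=.
    rewrite exchange_big big_distrr; apply: leq_sum => y' _ /=.
    rewrite -sum1dep_card leq_mul2l big_mkcondr /=; apply/orP; right.
    by apply: leq_sum => b _; case: (hit _ _).
  have [s0|s0] := posnP #|small|.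
    by have := none (0, 0)%R isT; rewrite -ltnNge s0.
  move=> h; have {}h : #|small| * n ^ 2 <= \sum_(y in Y) \sum_(y' in Y) #|small|.-1.
    rewrite -sum_nat_const; apply: (leq_trans h); apply: leq_sum => y _.
    apply: leq_sum => y' _; have := none (y, y')%R isT; rewrite -ltnNge /=; lia.
  move: h; rewrite !sum_nat_const -/n; have : 0 < n by []; nia.
exists d; pose Q := [set b in small | hit b d].
have sub : subrel (edge S V) (edge (d |: S) V).
  by move=> x y /and3P[xV yV xy]; rewrite /edge /= xV yV !inE; case/orP: xy => ->;
    rewrite !orbT.
have QR : Q \subset R.
  by apply/subsetP => b; rewrite inE => /andP[]; rewrite inE => /andP[].
have := @comp_roots_merge _ (edge S V) (edge (d |: S) V) V Q
  (fun b => fingraph.root (edge S V) (b + d)%R)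
  (@edge_connect_sym _ _) (@edge_connect_sym _ _) sub QR.
rewrite -/R => merge.
have {merge} : 2 * #|comp_roots (edge (d |: S) V) V| + #|Q| <= 2 * #|R|.
  apply: merge => b bQ; have bR := subsetP QR _ bQ.
  have bV := subsetP (comp_roots_sub S V) _ bR.
  move: bQ; rewrite inE => /andP[_]; rewrite /hit !inE => /andP[nb bdV].
  rewrite bdV /= in nb; split; first exact: imset_f.
    rewrite -[X in _ != X](comp_rootsP bR) root_connect; last exact: edge_connect_sym.
    by rewrite edge_connect_sym.
  apply: (@connect_trans _ _ (b + d)%R).
    by apply: connect1; rewrite /edge /= bV bdV !inE (addrAC b d) subrr add0r eqxx !orbT.
  by apply: (connect_sub _ (connect_root _ _)) => u v /sub; apply: connect1.
have : #|R| <= #|small| + #|R :\: small|.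
  by rewrite -(cardsID small R) leq_add2r subset_leq_card ?subsetIr.
move: dhit big_le; rewrite -/Q -/n.
move: (#|Q|) (#|R|) (#|small|) (#|R :\: small|) (#|V|) (#|comp_roots _ _|).
move: Y0; rewrite -/n => {}Y0 a b c e f g h1 h2 h3 h4.
have : 4 * q * g + c <= 4 * q * b by nia.
move=> h5; have : (4 * q * g + b) <= 4 * q * b + e by lia.
move=> /(leq_mul (leqnn n)); rewrite mulnDr; nia.
Qed.

End Growth.

(** * Encoding the subsets of a core by few group elements *)

Section Describe.
Variable G : finZmodType.
Implicit Types S U V W Y D : {set G}.

(** The first two terms of the binomial expansion suffice. Read as [(1 - 1/k)^k <= 1/2], it says
    that [k] contractions by [1 - 1/k] halve a quantity. *)
Lemma double_exp_pred_le k : 0 < k -> 2 * k.-1 ^ k <= k ^ k.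
Proof.
case: k => // k _ /=.
have bern j : k ^ j.+1 + j.+1 * k ^ j <= k.+1 ^ j.+1.
  elim: j => [|j IH]; first by rewrite !expn1 expn0; lia.
  rewrite (expnS k.+1) (expnS k j.+1); move: IH; rewrite (expnS k j).
  by move: (k.+1 ^ _) (k ^ _) => B a; nia.
by have := bern k; rewrite [k ^ k.+1]expnS; nia.
Qed.

(** Each use of [merge_step] shrinks the excess of components over [2q #|V| / #|Y|] by the factor
    [1 - 1/(4q)], so [4q] new differences halve it, and [s] halvings bring it from at most [2^s]
    down to at most 1. *)
Lemma few_components V Y q s : 0 < q -> 0 < #|Y| -> #|V| <= 2 ^ s ->
  {in V, forall x, #|Y| ^ 2 <= q * wdeg (rep Y) V x} ->
  exists S, #|S| <= 4 * q * s /\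
    #|comp_roots (edge S V) V| * #|Y| <= 2 * q * #|V| + #|Y|.
Proof.
move=> q0 Y0 Vs Vdeg; set n := #|Y|; set v := #|V|.
pose K := 4 * q; pose excess S := #|comp_roots (edge S V) V| * n - 2 * q * v.
have [S [St ex]] : exists S, #|S| <= K * s /\
    K ^ (K * s) * excess S <= K.-1 ^ (K * s) * excess set0.
  elim: (K * s) => [|t [S [St IH]]]; first by exists set0; rewrite cards0 !expn0.
  have [d hd] := merge_step S Y0 Vdeg; exists (d |: S); split.
    by rewrite cardsU1 -add1n leq_add // leq_b1.
  have step : K * excess (d |: S) <= K.-1 * excess S.
    move: hd; rewrite /excess -/K -/n -/v.
    move: (#|comp_roots (edge (d |: S) V) V|) (#|comp_roots _ _|) => c' c.
    have : 0 < K by rewrite muln_gt0.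
    case: (K) => // k _ /=; rewrite !mulnBr; move: (2 * q * v) => b; nia.
  rewrite !expnS -mulnA [K * _]mulnC -mulnA [excess _ * _]mulnC.
  apply: (leq_trans (leq_mul (leqnn _) step)).
  by rewrite mulnCA -[leqRHS]mulnA leq_mul.
exists S; split=> //.
have K0 : 0 < K.-1 ^ (K * s) by rewrite expn_gt0; apply/orP; left; rewrite /K; lia.
have K2 : 2 ^ s * K.-1 ^ (K * s) <= K ^ (K * s).
  by rewrite !(expnM _ K) -expnMn; case: (s) => // s'; rewrite leq_exp2r // double_exp_pred_le // muln_gt0.
have e0 : excess set0 <= 2 ^ s * n.
  rewrite /excess (leq_trans (leq_subr _ _)) // leq_mul2r (leq_trans _ Vs) ?orbT //.
  exact: leq_imset_card.
have : excess S <= n.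
  rewrite -(leq_pmul2l (m := 2 ^ s * K.-1 ^ (K * s))) ?muln_gt0 ?K0 ?expn_gt0 //.
  rewrite (leq_trans (leq_mul K2 (leqnn _))) // (leq_trans ex) //.
  by rewrite (leq_trans (leq_mul (leqnn _) e0)) // [in leqRHS]mulnAC mulnC.
by rewrite /excess leq_subLR.
Qed.

(** [D] plays two roles: its elements may start a new component, or serve as differences leading
    from [U] to a neighbour. *)
Definition reach D U : {set G} :=
  D :|: [set (u + d)%R | u in U, d in D] :|: [set (u - d)%R | u in U, d in D].

Fixpoint grown D k : {set {set G}} :=
  if k is k'.+1 then \bigcup_(U in grown D k') [set v |: U | v in reach D U]
  else [set set0].

Lemma card_reach D U : #|reach D U| <= #|D| * (1 + 2 * #|U|).
Proof.
have imc (f : G -> G -> G) : #|[set f u d | u in U, d in D]| <= #|U| * #|D|.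
  rewrite curry_imset2X (leq_trans (leq_imset_card _ _)) //.
  by rewrite cardsX.
rewrite /reach; have c1 := imc +%R; have c2 := imc (fun u d => u - d)%R.
rewrite (leq_trans (leq_card_setU _ _)) // mulnDr muln1 addnC.
rewrite (leq_trans (leq_add c2 (leq_of_leqif (leq_card_setU _ _)))) //.
by move: c1; move: (#|_|) (#|U|) (#|D|) => a b c; nia.
Qed.

Lemma grown_card_mem D k U : U \in grown D k -> #|U| <= k.
Proof.
elim: k U => [|k IH] U; first by rewrite inE => /eqP->; rewrite cards0.
move=> /bigcupP[U' U'k /imsetP[v _ ->]]; rewrite cardsU1 -add1n.
by rewrite leq_add ?leq_b1 // IH.
Qed.

Lemma card_bigcup_le (I T : finType) (P : pred I) (F : I -> {set T}) :
  #|\bigcup_(i | P i) F i| <= \sum_(i | P i) #|F i|.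
Proof.
elim/big_rec2: _ => [|i m A _ h]; first by rewrite cards0.
by rewrite (leq_trans (leq_card_setU _ _)) // leq_add2l.
Qed.

Lemma card_grown D k m : k <= m -> #|grown D k| <= (#|D| * (1 + 2 * m)) ^ k.
Proof.
elim: k => [|k IH] km; first by rewrite cards1.
rewrite expnSr (leq_trans (card_bigcup_le _ _)) //.
rewrite (leq_trans _ (leq_mul (IH (ltnW km)) (leqnn _))) // -sum_nat_const.
apply: leq_sum => U /grown_card_mem Uk.
rewrite (leq_trans (leq_imset_card _ _)) // (leq_trans (card_reach _ _)) //.
by rewrite leq_mul2l; apply/orP; right; lia.
Qed.

(** A set [U] inside [V] that contains every reachable element of [V] is closed under the edges and
    contains all roots, so it is [V]; otherwise it can grow by one element. *)
Lemma mem_grown S V D k : V != set0 -> S \subset D ->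
  comp_roots (edge S V) V \subset D -> #|V| <= k -> V \in grown D k.
Proof.
move=> /set0Pn[x0 x0V] SD RD Vk.
have [U [Uk UV UVk]] : exists U, [/\ U \in grown D k, U \subset V & minn k #|V| <= #|U|].
  elim: k {Vk} => [|k [U [Uk UV kU]]].
    by exists set0; rewrite inE eqxx sub0set min0n.
  (* Once [U] is all of [V], adding a root again uses up the remaining steps. *)
  have [VU|] := boolP (V \subset U).
    have eUV : U = V by apply/eqP; rewrite eqEsubset UV.
    pose r := fingraph.root (edge S V) x0; have rR : r \in comp_roots (edge S V) V.
      exact: imset_f.
    exists V; split; rewrite ?geq_minr //; apply/bigcupP; exists U => //.
    apply/imsetP; exists r; first by rewrite !inE (subsetP RD).
    rewrite eUV; apply/esym/setUidPr; rewrite sub1set.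
    exact: (subsetP (comp_roots_sub S V)).
  move=> /subsetPn[v vV vU].
  suff [w wV /andP[wU wr]] : exists2 w, w \in V & (w \notin U) && (w \in reach D U).
    exists (w |: U); split.
    - by apply/bigcupP; exists U => //; apply/imsetP; exists w.
    - by rewrite subUset sub1set wV.
    - by rewrite cardsU1 wU; lia.
  apply/exists_inP; apply: contraT => /exists_inPn none.
  have inU w : w \in V -> w \in reach D U -> w \in U.
    by move=> wV wr; have := none w wV; rewrite wr andbT negbK.
  have cl : fingraph.closed (edge S V) U.
    apply: (intro_closed (@edge_connect_sym _ S V)) => x y /and3P[xV yV xy] xU.
    apply: inU => //; rewrite !inE; case/orP: xy => /(subsetP SD) d.
      by apply/orP; right; apply/imset2P; exists x (x - y)%R; rewrite // subKr.
    apply/orP; left; apply/orP; right; apply/imset2P.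
    by exists x (y - x)%R; rewrite // addrC subrK.
  have rR : fingraph.root (edge S V) v \in comp_roots (edge S V) V by apply: imset_f.
  have rV := subsetP (comp_roots_sub S V) _ rR.
  have := closed_connect cl (connect_root _ v); rewrite (negPf vU) => /esym.
  by rewrite inU // !inE (subsetP RD).
by have -> : V = U by apply/esym/eqP; rewrite eqEcard UV (leq_trans _ UVk) // leq_min Vk leqnn.
Qed.

(** [g] lists differences and component roots, the core [V] is built from them in [m] additions, and
    [powerset] allows for the choice of a layer inside the core. *)
Definition described tau m : {set {set G}} :=
  \bigcup_(g : {ffun 'I_tau -> G}) \bigcup_(V in grown (g @: setT) m) powerset V.

Lemma card_described tau m :
  #|described tau m| <= #|G| ^ tau * (2 * (tau * (1 + 2 * m))) ^ m.
Proof.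
rewrite (leq_trans (card_bigcup_le _ _)) //.
rewrite -[tau in _ ^ tau]card_ord -card_ffun -sum_nat_const leq_sum // => g _.
rewrite (leq_trans (card_bigcup_le _ _)) // expnMn mulnC.
apply: (@leq_trans (#|grown (g @: setT) m| * 2 ^ m)).
  rewrite -sum_nat_const; apply: leq_sum => V /grown_card_mem Vm.
  by rewrite card_powerset leq_exp2l.
rewrite leq_mul2r (leq_trans (card_grown _ (leqnn m))) ?orbT //.
case: m => // m; rewrite leq_exp2r // leq_mul2r; apply/orP; right.
by rewrite (leq_trans (leq_imset_card _ _)) // cardsT card_ord.
Qed.

Lemma mem_described V W Y q s m :
  0 < q -> #|V| <= 2 ^ s -> #|V| <= #|Y| -> #|V| <= m ->
  {in V, forall x, #|Y| ^ 2 <= q * wdeg (rep Y) V x} ->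
  V != set0 -> W \subset V -> W \in described (4 * q * s.+1) m.
Proof.
move=> q0 Vs VY Vm Vdeg V0 WV.
have Y0 : 0 < #|Y| by rewrite (leq_trans _ VY) // card_gt0.
have [S [St Rn]] := few_components q0 Y0 Vs Vdeg.
set R := comp_roots _ _ in Rn.
(* As [#|V| <= #|Y|], there are at most [2q + 1 <= 4q] roots; they account for the extra [4q] in
   [4q(s + 1)]. *)
have Rq : #|R| <= 4 * q by nia.
have /subsetP SRg : S :|: R \subset [set x in enum (S :|: R)].
  by apply/subsetP => x xSR; rewrite inE mem_enum.
have tau_ge : size (enum (S :|: R)) <= 4 * q * s.+1.
  rewrite -cardE (leq_trans (leq_card_setU _ _)) // mulnS addnC.
  by rewrite leq_add.
pose g := [ffun i : 'I_(4 * q * s.+1) => nth 0%R (enum (S :|: R)) i].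
have SRD : S :|: R \subset g @: setT.
  apply/subsetP => x xSR; have xe : x \in enum (S :|: R) by rewrite mem_enum.
  apply/imsetP; have it : index x (enum (S :|: R)) < 4 * q * s.+1.
    by rewrite (leq_trans _ tau_ge) // index_mem.
  by exists (Ordinal it) => //; rewrite ffunE /= nth_index.
apply/bigcupP; exists g => //; apply/bigcupP; exists V; last by rewrite inE.
move: SRD; rewrite subUset => /andP[SD RD].
exact: (mem_grown V0 SD RD Vm).
Qed.

End Describe.

Local Open Scope ring_scope.

(** * Exponential moments and a Chernoff bound for random sets *)

Section Chernoff.
Variable R : realType.

(** For [x >= 1/2] already [x <= 2 x^2]. For smaller [x], with [a = e^(x/2)] and [b = 1/a], the left
    side is [2 + (a - b)^2 <= 2 + 4 x^2]. *)
Lemma cosh_le (x : R) : expR x + expR (- x) <= 2 * expR (2 * x ^+ 2).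
Proof.
wlog x0 : x / 0 <= x => [H|].
  have [/H//|/ltW] := leP 0 x; rewrite -oppr_ge0 => /H.
  by rewrite opprK sqrrN addrC.
have [x1|x1] := leP (1 / 2) x.
  rewrite mulr_natl mulr2n lerD // ler_expR; nra.
have := @expR_ge1Dx R (2 * x ^+ 2).
have := @expR_ge1Dx R (- (x / 2)); have := @expR_ge1Dx R (x / 2).
have -> : expR x = expR (x / 2) ^+ 2 by rewrite expr2 -expRD -splitr.
have -> : expR (- x) = expR (- (x / 2)) ^+ 2.
  by rewrite expr2 -expRD -opprD -splitr.
have : expR (x / 2) * expR (- (x / 2)) = 1 by rewrite -expRD subrr expR0.
set a := expR (x / 2); set b := expR (- (x / 2)); set e := expR _.
move=> ab a1 b1 e1.
have a2 : a * (1 - x / 2) <= 1 by rewrite -[leRHS]ab ler_pM2l ?expR_gt0.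
have ab2 : a - b <= 2 * x by nra.
have ba : b <= a by rewrite /a /b ler_expR; lra.
have : (a - b) ^+ 2 <= (2 * x) ^+ 2 by rewrite ler_sqr ?nnegrE; lra.
nra.
Qed.

Variable T : finType.

Definition signed (B : {set T}) (z : T) : R := if z \in B then 1 else -1.

Lemma sum_expR_signed (c : T -> R) :
  \sum_(B : {set T}) expR (\sum_z c z * signed B z)
    = \prod_z (expR (c z) + expR (- c z)).
Proof.
rewrite bigA_distr /=; apply: eq_bigr => B _.
rewrite expR_sum; apply: eq_bigr => z _.
by rewrite /signed; case: ifP; rewrite ?mulr1 ?mulrN1.
Qed.

(** Exponential Markov inequality, with sets counted instead of probabilities. The quadratic part of
    the threshold cancels exactly the bound coming from [cosh_le]. *)
Lemma chernoff_count (c : T -> R) (lam th : R) : 0 <= lam ->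
  #|[set B : {set T} | 2 * lam * \sum_z c z ^+ 2 + th <= \sum_z c z * signed B z]|%:R
    <= 2 ^+ #|T| * expR (- (lam * th)).
Proof.
move=> lam0; set E := [set B | _].
pose C := 2 * lam ^+ 2 * \sum_z c z ^+ 2.
rewrite -(ler_pM2r (expR_gt0 (C + lam * th))) -mulrA -expRD addrCA addNr addr0.
have h1 : #|E|%:R * expR (C + lam * th) <=
    \sum_(B : {set T}) expR (\sum_z lam * c z * signed B z).
  rewrite mulr_natl -sumr_const [leRHS](bigID (mem E)) /=.
  apply: ler_wpDr; first by apply: sumr_ge0 => B _; apply: expR_ge0.
  apply: ler_sum => B; rewrite inE ler_expR => hB.
  under eq_bigr do rewrite -mulrA; rewrite -mulr_sumr.
  apply: le_trans (ler_wpM2l lam0 hB); rewrite mulrDr lerD2r /C.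
  by rewrite le_eqVlt; apply/orP; left; apply/eqP; ring.
apply: (le_trans h1); rewrite sum_expR_signed.
rewrite /C mulr_sumr expR_sum -prodr_const -big_split /=.
apply: ler_prod => z _; rewrite addr_ge0 ?expR_ge0 //=.
by rewrite (le_trans (cosh_le _)) // exprMn mulrA.
Qed.

End Chernoff.

(** * Random sampling with second moments *)

Section Sampling.
Variables (R : realType) (I : finType) (Y : {set I}) (l : nat).
Hypothesis Y0 : (0 < #|Y|)%N.
Let n : R := #|Y|%:R.
Let avg (g : I -> R) : R := n^-1 * \sum_(y in Y) g y.
(** Expectation over [l] independent uniform elements of [Y]. *)
Let Ex (F : {ffun 'I_l -> I} -> R) : R :=
  \sum_(f in ffun_on [in Y]) n^-1 ^+ l * F f.

Let n_neq0 : n != 0. Proof. by rewrite pnatr_eq0 -lt0n. Qed.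

Let Ex_prod (F : 'I_l -> I -> R) :
  Ex (fun f => \prod_i F i (f i)) = \prod_i avg (F i).
Proof.
rewrite /avg; under [RHS]eq_bigr do rewrite mulr_sumr.
rewrite bigA_distr_big; apply: eq_bigr => f _.
by rewrite big_split /= prodr_const card_ord.
Qed.

Let avg1 : avg (fun=> 1) = 1.
Proof. by rewrite /avg sumr_const mulVf. Qed.

Let Ex1 : Ex (fun=> 1) = 1.
Proof.
have := Ex_prod (fun _ _ => 1); rewrite [RHS]big1 => [h|i _]; last exact: avg1.
by rewrite -[RHS]h; apply: eq_bigr => f _; rewrite big1.
Qed.

Let Ex_single a (g : I -> R) : Ex (fun f => g (f a)) = avg g.
Proof.
have := Ex_prod (fun i => if i == a then g else fun=> 1).
rewrite [RHS](bigD1 a) //= eqxx big1 => [|i /negPf->]; last exact: avg1.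
rewrite mulr1 => <-; apply: eq_bigr => f _; congr (_ * _).
by rewrite (bigD1 a) //= eqxx big1 ?mulr1 // => i /negPf->.
Qed.

Let Ex_pair a b (u v : I -> R) : a != b ->
  Ex (fun f => u (f a) * v (f b)) = avg u * avg v.
Proof.
move=> ab; have ba : b != a by rewrite eq_sym.
have := Ex_prod (fun i => if i == a then u else if i == b then v else fun=> 1).
rewrite [RHS](bigD1 a) //= eqxx (bigD1 b) //= eqxx (negPf ba).
rewrite big1 => [|i /andP[/negPf-> /negPf->]]; last exact: avg1.
rewrite mulr1 => <-; apply: eq_bigr => f _; congr (_ * _).
rewrite (bigD1 a) //= eqxx (bigD1 b) //= eqxx (negPf ba).
by rewrite big1 ?mulr1 // => i /andP[/negPf-> /negPf->].
Qed.

Let Ex_sum (J : finType) (F : J -> {ffun 'I_l -> I} -> R) :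
  Ex (fun f => \sum_j F j f) = \sum_j Ex (F j).
Proof.
rewrite /Ex exchange_big; apply: eq_bigr => f _; exact: mulr_sumr.
Qed.

(** The diagonal terms of the square give the first summand; the others, at most [l^2] in number,
    factor by independence. *)
Let Ex_square (h : I -> R) :
  Ex (fun f => (\sum_a h (f a)) ^+ 2)
    <= l%:R * avg (fun y => h y ^+ 2) + l%:R ^+ 2 * avg h ^+ 2.
Proof.
have -> : Ex (fun f => (\sum_a h (f a)) ^+ 2) =
    \sum_a \sum_b Ex (fun f => h (f a) * h (f b)).
  rewrite -(eq_bigr _ (fun a _ => Ex_sum _)) -Ex_sum.
  apply: eq_bigr => f _; congr (_ * _); rewrite expr2 mulr_suml.
  by apply: eq_bigr => a _; rewrite mulr_sumr.
apply: (@le_trans _ _ (\sum_(a < l) (avg (fun y => h y ^+ 2) + l%:R * avg h ^+ 2))).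
  apply: ler_sum => a _; rewrite (bigD1 a) //= lerD //.
    by rewrite -(Ex_single a).
  rewrite (eq_bigr (fun=> avg h ^+ 2)); last first.
    by move=> b ba; rewrite Ex_pair 1?eq_sym // expr2.
  rewrite sumr_const -[leLHS]mulr_natl ler_wpM2r ?sqr_ge0 // ler_nat.
  by rewrite (leq_trans (max_card _)) ?card_ord.
by rewrite sumr_const card_ord -[leLHS]mulr_natl mulrDr mulrA -expr2.
Qed.

(** Gain and second-moment penalty stay in one expression, so that a single [f] reaching its average
    controls both. *)
Lemma sampling (J : finType) (g : I -> R) (h : I -> J -> R) (mu : R) : 0 <= mu ->
  exists f : {ffun 'I_l -> I},
    l%:R * avg g - mu * \sum_z (l%:R * avg (fun y => h y z ^+ 2)
                                + l%:R ^+ 2 * avg (h^~ z) ^+ 2)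
    <= \sum_a g (f a) - mu * \sum_z (\sum_a h (f a) z) ^+ 2.
Proof.
move=> mu0; pose c := l%:R * avg g - mu * \sum_z (l%:R * avg (fun y => h y z ^+ 2)
                                + l%:R ^+ 2 * avg (h^~ z) ^+ 2).
rewrite -/c.
apply/not_existsP => none.
have : c <= Ex (fun f => \sum_a g (f a) - mu * \sum_z (\sum_a h (f a) z) ^+ 2).
  have -> : Ex (fun f => \sum_a g (f a) - mu * \sum_z (\sum_a h (f a) z) ^+ 2)
    = Ex (fun f => \sum_a g (f a)) - mu * Ex (fun f => \sum_z (\sum_a h (f a) z) ^+ 2).
    rewrite /Ex mulr_sumr -sumrB; apply: eq_bigr => f _.
    by rewrite mulrBr mulrCA.
  rewrite !Ex_sum (eq_bigr _ (fun a _ => Ex_single a g)) sumr_const card_ord.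
  rewrite -[avg g *+ l]mulr_natl lerD2l lerN2 ler_wpM2l //; apply: ler_sum => z _.
  exact: Ex_square.
rewrite leNgt => /negP; apply.
rewrite -[ltRHS]mulr1 -[X in _ < _ * X]Ex1.
have [y0 y0Y] := card_gt0P Y0.
have w0 : 0 < n^-1 ^+ l by rewrite exprn_gt0 // invr_gt0 ltr0n.
rewrite /Ex mulr_sumr; apply: ltr_sum => [|f _].
  apply/hasP; exists [ffun=> y0]; first by rewrite mem_index_enum.
  by apply/ffun_onP => i; rewrite ffunE.
rewrite mulr1 [ltRHS]mulrC ltr_pM2l // ltNge; exact/negP/none.
Qed.

End Sampling.

(** * Dyadic layers and the union bound for biased pairs *)

Lemma sum_layers (V : zmodType) (T : finType) (C : nat -> {set T}) (h : T -> V) s :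
  C 0%N = set0 -> (forall j, C j \subset C j.+1) ->
  \sum_(x in C s) h x = \sum_(j < s) \sum_(x in C j.+1 :\: C j) h x.
Proof.
move=> C0 Cs; elim: s => [|s IH]; first by rewrite C0 big_set0 big_ord0.
rewrite big_ord_recr /= -IH (big_setID (C s)) /=.
by rewrite (setIidPr (Cs s)).
Qed.

Section Union.
Variables (R : realType) (G : finZmodType).
Implicit Types (W X Y B : {set G}).

(** Twice the deviation of the count of sums in [B] from [#|X| #|Y| / 2]. *)
Definition bias B X Y : R := \sum_(x in X) \sum_(y in Y) signed R B (x + y).

(** The convolution of [W] with the multiset of values of [f]. *)
Definition hitting W l (f : {ffun 'I_l -> G}) (z : G) : R :=
  \sum_(a < l) (z - f a \in W)%:R.

(* The threshold contains the energy of [W] against the sample [f], so that the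
   Chernoff bound for this event depends on [lam] and [th] only. *)
Definition deviates W l (f : {ffun 'I_l -> G}) (lam th : R) : {set {set G}} :=
  finset (fun B => 2 * lam * \sum_z hitting W f z ^+ 2 + th
                   <= \sum_z hitting W f z * signed R B z).

Lemma sum_translate W (y : G) (u : G -> R) :
  \sum_z (z - y \in W)%:R * u z = \sum_(x in W) u (x + y).
Proof.
rewrite (reindex_inj (addIr y)) [RHS]big_mkcond /=; apply: eq_bigr => x _.
by rewrite addrK; case: (x \in W); rewrite ?mul1r ?mul0r.
Qed.

Lemma sum_square_translate W Y :
  \sum_z (\sum_(y in Y) (z - y \in W)%:R) ^+ 2
    = (\sum_(x in W) wdeg (rep Y) W x)%:R :> R.
Proof.
under [LHS]eq_bigr => z _ do rewrite expr2 mulr_suml.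
rewrite exchange_big natr_sum /=.
under [RHS]eq_bigr => x _ do rewrite wdeg_rep natr_sum.
rewrite [RHS]exchange_big; apply: eq_bigr => y _ /=.
rewrite sum_translate; apply: eq_bigr => x _.
by rewrite natr_sum; apply: eq_bigr => y' _; rewrite addrA.
Qed.

(** On average a sample carries [l / #|Y|] times the bias, while the energy hypothesis bounds the
    mean of [\sum_z hitting W f z ^+ 2] by [5 l #|W|]. With the factor [2 (eps / 20)] this costs at
    most [(eps / 2) l #|W|], the amount set aside in the hypothesis. *)
Lemma exists_deviating_sample B W Y l j (eps th : R) :
  (0 < #|Y|)%N -> l = (2 ^ j.+1)%N -> 0 <= eps ->
  (2 ^ j * \sum_(x in W) wdeg (rep Y) W x <= 2 * #|Y| ^ 2 * #|W|)%N ->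
  l%:R * (eps / 2 * #|W|%:R) * #|Y|%:R + th * #|Y|%:R <= l%:R * bias B W Y ->
  exists f : {ffun 'I_l -> G}, B \in deviates W f (eps / 20) th.
Proof.
move=> Y0 lE eps0 energy big; set n : R := #|Y|%:R.
have n0 : 0 < n by rewrite ltr0n.
have mu0 : 0 <= 2 * (eps / 20) by lra.
have [f] := @sampling R _ Y l Y0 _ (fun y => \sum_(x in W) signed R B (x + y))
  (fun y z => (z - y \in W)%:R) _ mu0.
rewrite -/n => hf; exists f; rewrite inE.
have -> : \sum_z hitting W f z * signed R B z =
    \sum_a \sum_(x in W) signed R B (x + f a).
  under eq_bigr => z _ do rewrite mulr_suml.
  by rewrite exchange_big; apply: eq_bigr => a _; rewrite sum_translate.
suff : th <= \sum_(a < l) \sum_(x in W) signed R B (x + f a)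
        - 2 * (eps / 20) * \sum_z hitting W f z ^+ 2 by lra.
apply: le_trans hf.
have -> : \sum_z (l%:R * (n^-1 * \sum_(y in Y) (z - y \in W)%:R ^+ 2) +
     l%:R ^+ 2 * (n^-1 * \sum_(y in Y) (z - y \in W)%:R) ^+ 2)
   = l%:R * #|W|%:R + l%:R ^+ 2 * n^-1 ^+ 2 * (\sum_(x in W) wdeg (rep Y) W x)%:R.
  rewrite big_split /= -!mulr_sumr; congr (_ + _).
    rewrite exchange_big /= (eq_bigr (fun=> #|W|%:R)); last first.
      move=> y _; rewrite -sum1_card natr_sum.
      rewrite -[RHS](sum_translate W y (fun=> 1)); apply: eq_bigr => z _.
      by rewrite mulr1; case: (_ \in W); rewrite ?expr1n ?expr0n.
    by rewrite sumr_const -[_ *+ #|Y|]mulr_natl mulKf // gt_eqF.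
  rewrite (eq_bigr _ (fun z _ => exprMn _ _ _)).
  by rewrite -mulr_sumr sum_square_translate mulrA.
move: energy; set E := (\sum_(_ in _) _)%N => energy.
have {}energy : l%:R ^+ 2 * n^-1 ^+ 2 * E%:R <= 4 * l%:R * #|W|%:R.
  have : (2 ^ j)%:R * E%:R <= 2 * n ^+ 2 * #|W|%:R :> R.
    by rewrite /n -!natrX -!natrM ler_nat.
  rewrite -(ler_pM2l (_ : 0 < 4 * (2 ^ j)%:R * n^-1 ^+ 2)); last first.
    by rewrite !mulr_gt0 ?exprn_gt0 ?invr_gt0 ?ltr0n ?expn_gt0.
  have -> : l%:R = 2 * (2 ^ j)%:R :> R by rewrite lE expnS natrM.
  set p := (2 ^ j)%:R; move=> h; apply: (le_trans _ (le_trans h _)).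
    by rewrite le_eqVlt; apply/orP; left; apply/eqP; ring.
  rewrite le_eqVlt; apply/orP; left; apply/eqP; field; exact: lt0r_neq0.
have -> : l%:R * (n^-1 * \sum_(y in Y) \sum_(x in W) signed R B (x + y))
    = n^-1 * (l%:R * bias B W Y).
  by rewrite /bias [X in _ = _ * (_ * X)]exchange_big /= mulrCA.
have : l%:R * (eps / 2 * #|W|%:R) + th <= n^-1 * (l%:R * bias B W Y).
  rewrite -(ler_pM2l n0) mulVKf ?gt_eqF //; apply: le_trans big.
  by rewrite mulrDr [X in X + _]mulrC [X in _ + X]mulrC.
have := mulr_ge0 mu0 (ler0n R E).
have : 2 * (eps / 20) * (l%:R ^+ 2 * n^-1 ^+ 2 * E%:R)
     <= 2 * (eps / 20) * (4 * l%:R * #|W|%:R) by apply: ler_wpM2l.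
lra.
Qed.

(** Half of [eps] is subtracted from each row to pay for the energy of the sample; by pigeonhole
    over the [s] layers, one of them receives a share [eps / (2s)] of the rest. *)
Lemma biased_deviates B X Y s (eps : R) : 0 < eps ->
  (0 < #|X|)%N -> (#|X| < #|Y|)%N -> (#|Y| <= 2 ^ s)%N ->
  eps * #|X|%:R * #|Y|%:R < bias B X Y ->
  exists j : 'I_s, (#|Y| <= #|X| * 2 ^ j.+1)%N /\
  exists2 W, W \in described G (4 * 2 ^ j.+1 * s.+1) #|X| &
  exists f : {ffun 'I_(2 ^ j.+1) -> G},
    B \in deviates W f (eps / 20) ((2 ^ j.+1)%:R * (eps / (2 * s%:R)) * #|X|%:R).
Proof.
move=> eps0 X0 XY Ys big.
have Y0 : (0 < #|Y|)%N by apply: leq_trans XY.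
have s0 : (0 < s)%N by case: s Ys => //; move: X0 XY; lia.
pose C j := core (rep Y) (#|Y| ^ 2) (2 ^ j) X.
have CX j : C j \subset X by apply: core_sub.
(* Degrees are at most [#|X| #|Y|], so a nonempty core at scale [2^j] needs [#|Y| <= #|X| 2^j]; in
   particular the core at scale 1 is empty. *)
have Cbig j x : x \in C j -> (#|Y| <= #|X| * 2 ^ j)%N.
  move=> /[dup] /core_wdeg; rewrite -/(C j) => h xC.
  rewrite -(leq_pmul2l Y0) mulnA (leq_trans h) // mulnC leq_mul2r.
  rewrite (leq_trans (wdeg_rep_le _ _ _)) ?orbT // leq_mul2l.
  by rewrite subset_leq_card ?orbT.
have C0 : C 0%N = set0.
  apply/eqP; rewrite -subset0; apply/subsetP => x /Cbig.
  by rewrite expn0 muln1 leqNgt XY.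
(* The pairs with [y = y'] make every degree at least [#|Y|], so the scale [2^s >= #|Y|] exhausts
   [X]. *)
have Cs : C s = X.
  apply/eqP; rewrite eqEsubset CX; apply: core_max => // x xX.
  by rewrite expnS expn1 leq_mul // wdeg_rep_ge.
have CS j : C j \subset C j.+1 by apply: core_leq; rewrite leq_exp2l.
pose n : R := #|Y|%:R; pose m : R := #|X|%:R.
have [j hj] : exists j : 'I_s, eps / (2 * s%:R) * m * n <
    \sum_(x in C j.+1 :\: C j) (\sum_(y in Y) signed R B (x + y) - eps / 2 * n).
  apply/not_existsP => none; move: big; apply/negP; rewrite -leNgt.
  have := sum_layers (fun x => \sum_(y in Y) signed R B (x + y) - eps / 2 * n) s C0 CS.
  rewrite Cs big_split /= -/(bias B X Y) sumr_const -[_ *+ #|X|]mulr_natl -/m => h.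
  have : bias B X Y + m * (- (eps / 2 * n)) <= s%:R * (eps / (2 * s%:R) * m * n).
    rewrite h; apply: (@le_trans _ _ (\sum_(j < s) eps / (2 * s%:R) * m * n)).
      by apply: ler_sum => j _; rewrite leNgt; apply/negP/none.
    by rewrite sumr_const card_ord (mulr_natl _ s).
  have -> : s%:R * (eps / (2 * s%:R) * m * n) = eps / 2 * m * n.
    by field; rewrite pnatr_eq0 -lt0n.
  rewrite -/m -/n; lra.
exists j; set W := C j.+1 :\: C j in hj.
have [x xW] : exists x, x \in W.
  apply/set0Pn/eqP => W0; move: hj; rewrite W0 big_set0; apply/negP.
  by rewrite -leNgt !mulr_ge0 ?invr_ge0 ?mulr_ge0 ?ler0n // ltW.
have xV : x \in C j.+1 by move: xW; rewrite inE => /andP[].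
split; first exact: Cbig xV.
exists W.
  apply: (@mem_described _ (C j.+1) _ Y).
  - by rewrite expn_gt0.
  - by rewrite (leq_trans (subset_leq_card (CX _))) // (leq_trans (ltnW XY)).
  - by rewrite (leq_trans (subset_leq_card (CX _))) // (ltnW XY).
  - exact: subset_leq_card.
  - by move=> z zC; apply: core_wdeg.
  - by apply/set0Pn; exists x.
  - exact: subsetDl.
apply: (@exists_deviating_sample B W Y _ j) => //; first exact: ltW.
  by apply: core_diff_energy; apply: repC.
move: hj; rewrite big_split /= -/(bias B W Y) sumr_const -[_ *+ #|W|]mulr_natl.
rewrite -/n -/m => hj.
rewrite -!mulrA -mulrDr ler_wpM2l ?ler0n //; move: hj; rewrite -!mulrA; lra.
Qed.

Definition biased (m n : nat) (eps : R) : {set {set G}} :=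
  finset (fun B => [exists X : {set G}, exists Y : {set G},
    [&& #|X| == m, #|Y| == n & eps * m%:R * n%:R < bias B X Y]]).

(** Union bound over the scale, the described layer and the sample; the factors count layers,
    samples, and the sets in one Chernoff event. *)
Lemma card_biased m n s (eps : R) : 0 < eps ->
  (0 < m)%N -> (m < n)%N -> (n <= 2 ^ s)%N ->
  #|biased m n eps|%:R <= \sum_(j < s | (n <= m * 2 ^ j.+1)%N)
    (#|G| ^ (4 * 2 ^ j.+1 * s.+1) *
     (2 * (4 * 2 ^ j.+1 * s.+1 * (1 + 2 * m))) ^ m * #|G| ^ (2 ^ j.+1))%:R *
    (2 ^+ #|G| *
      expR (- (eps / 20 * ((2 ^ j.+1)%:R * (eps / (2 * s%:R)) * m%:R)))) :> R.
Proof.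
move=> eps0 m0 mn ns.
pose th j : R := (2 ^ j.+1)%:R * (eps / (2 * s%:R)) * m%:R.
have sub : biased m n eps \subset
    \bigcup_(j < s | (n <= m * 2 ^ j.+1)%N)
    \bigcup_(W in described G (4 * 2 ^ j.+1 * s.+1) m)
    \bigcup_(f : {ffun 'I_(2 ^ j.+1) -> G}) deviates W f (eps / 20) (th j).
  apply/subsetP => B; rewrite inE => /existsP[X /existsP[Y /and3P[/eqP Xm /eqP Yn]]].
  move=> big; have {}big : eps * #|X|%:R * #|Y|%:R < bias B X Y by rewrite Xm Yn.
  have X0 : (0 < #|X|)%N by rewrite Xm.
  have XY : (#|X| < #|Y|)%N by rewrite Xm Yn.
  have Ys : (#|Y| <= 2 ^ s)%N by rewrite Yn.
  have [j [hj [W WD [f fB]]]] := biased_deviates eps0 X0 XY Ys big.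
  rewrite Xm Yn in hj; rewrite Xm in WD fB.
  apply/bigcupP; exists j => //; apply/bigcupP; exists W => //.
  by apply/bigcupP; exists f.
apply: le_trans (_ : _ <= _%:R) _; first by rewrite ler_nat; apply: subset_leq_card sub.
apply: le_trans (_ : _ <= _%:R) _; first by rewrite ler_nat; apply: card_bigcup_le.
rewrite natr_sum; apply: ler_sum => j _.
set c := _ * expR _.
have c0 : 0 <= c by rewrite mulr_ge0 ?expR_ge0 ?exprn_ge0.
apply: le_trans (_ : _ <= _%:R) _; first by rewrite ler_nat; apply: card_bigcup_le.
have fW W : #|\bigcup_(f : {ffun 'I_(2 ^ j.+1) -> G}) deviates W f (eps / 20) (th j)|%:R
    <= (#|G| ^ 2 ^ j.+1)%:R * c.
  apply: le_trans (_ : _ <= _%:R) _; first by rewrite ler_nat; apply: card_bigcup_le.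
  rewrite natr_sum mulr_natl -[in leRHS](card_ord (2 ^ j.+1)) -card_ffun -sumr_const.
  by apply: ler_sum => f _; apply: chernoff_count; rewrite divr_ge0 // ltW.
rewrite natr_sum; apply: (le_trans (ler_sum _ (fun W _ => fW W))).
rewrite sumr_const -[leLHS]mulr_natl natrM -mulrA ler_wpM2r ?mulr_ge0 ?ler0n //.
by rewrite ler_nat card_described.
Qed.

End Union.

(** * Rarity of biased sets at fixed sizes *)

Section Rare.
Variables (R : realType) (G : finZmodType).
Implicit Types (X Y B : {set G}).

(** Repeatedly deleting an element whose value is at most the average does not lower the mean. *)
Lemma subset_average (T : finType) (g : T -> R) (X : {set T}) k :
  (0 < k <= #|X|)%N ->
  exists X' : {set T}, [/\ X' \subset X, #|X'| = k &
    k%:R * \sum_(x in X) g x <= #|X|%:R * \sum_(x in X') g x].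
Proof.
move=> /andP[k0]; have [d] := ubnP (#|X| - k)%N.
elim: d X => // d IH X dX; rewrite leq_eqVlt => /predU1P[kX|kX].
  by exists X; split; rewrite // kX.
have X0 : (0 < #|X|)%N by lia.
have [x xX xmin] : exists2 x, x \in X & #|X|%:R * g x <= \sum_(x in X) g x.
  apply/exists_inP; apply: contraT => /exists_inPn none.
  have [x0 x0X] := card_gt0P X0.
  have : \sum_(x in X) \sum_(y in X) g y < \sum_(x in X) #|X|%:R * g x.
    apply: ltr_sum => [|x xX]; last by rewrite ltNge none.
    by apply/hasP; exists x0; rewrite // mem_index_enum.
  by rewrite -mulr_sumr sumr_const mulr_natl ltxx.
have cX := cardsD1 x X; rewrite xX add1n in cX.
have [||X' [X'X X'k h]] := IH (X :\ x); [by lia | by lia |].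
exists X'; split=> //; first exact: subset_trans X'X (subsetDl _ _).
have e0 : 0 < #|X :\ x|%:R :> R by rewrite ltr0n; lia.
rewrite -(ler_pM2l e0) [leRHS]mulrCA.
apply: le_trans (ler_wpM2l (ler0n _ _) h).
rewrite [leLHS]mulrCA [leRHS]mulrCA ler_wpM2l ?ler0n //.
move: xmin; rewrite (big_setD1 x) //= cX -natr1.
set e := #|_|%:R; set S := \sum_(_ in _) _; lra.
Qed.

(** Averaging over [X] and then over [Y], a pair with too much bias contains one of sizes exactly
    [m] and [n] with no smaller density of bias. *)
Lemma unbiased_large B (m n : nat) (eps : R) X Y :
  (0 < m <= #|X|)%N -> (0 < n <= #|Y|)%N -> B \notin biased G m n eps ->
  bias R B X Y <= eps * (#|X|%:R * #|Y|%:R).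
Proof.
move=> mX nY; apply: contraR; rewrite -ltNge => big.
have [X' [_ X'm hX]] := subset_average (fun x => \sum_(y in Y) signed R B (x + y)) mX.
have [Y' [_ Y'n hY]] := subset_average (fun y => \sum_(x in X') signed R B (x + y)) nY.
have swap (Z : {set G}) : \sum_(y in Z) \sum_(x in X') signed R B (x + y) = bias R B X' Z.
  by rewrite exchange_big.
rewrite inE; apply/existsP; exists X'; apply/existsP; exists Y'.
rewrite X'm Y'n !eqxx /=; move: hX hY mX nY.
rewrite !swap -/(bias R B X Y) -/(bias R B X' Y).
move=> hX hY /andP[m0 mX] /andP[n0 nY].
have x0 : 0 < #|X|%:R :> R by rewrite ltr0n (leq_trans m0).
have y0 : 0 < #|Y|%:R :> R by rewrite ltr0n (leq_trans n0).
rewrite -(ltr_pM2l y0) -(ltr_pM2l x0).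
apply: lt_le_trans (ler_wpM2l (ltW x0) hY); rewrite [ltRHS]mulrCA.
have n0' : 0 < n%:R :> R by rewrite ltr0n.
have m0' : 0 < m%:R :> R by rewrite ltr0n.
apply: lt_le_trans (ler_wpM2l (ltW n0') hX); rewrite [ltRHS]mulrA.
have h : n%:R * m%:R * (eps * (#|X|%:R * #|Y|%:R)) < n%:R * m%:R * bias R B X Y.
  by rewrite ltr_pM2l ?mulr_gt0.
apply: le_lt_trans h; rewrite le_eqVlt; apply/orP; left; apply/eqP; ring.
Qed.

(** Follows from [e^(-1/2) >= 1/2]; it serves to bound [2^(2k)] below by [e^k]. *)
Lemma expR1_le4 : expR (1 : R) <= 4.
Proof.
have := @expR_ge1Dx R (- (1 / 2)); have := @expR_gt0 R (1 / 2).
have -> : expR (1 : R) = expR (1 / 2) ^+ 2 by rewrite expr2 -expRD -splitr.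
have : expR (1 / 2) * expR (- (1 / 2)) = 1 :> R by rewrite -expRD subrr expR0.
move: (expR (1 / 2)) (expR (- (1 / 2))) => a b; nra.
Qed.

Lemma pow2_le_expR k : (2 ^ k)%:R <= expR k%:R :> R.
Proof.
rewrite -[k%:R]mulr1 expRM_natl natrX lerXn2r ?nnegrE ?expR_ge0 //.
by have := @expR_ge1Dx R 1; lra.
Qed.

Lemma description_size_le q m s : (q <= 2 ^ s)%N -> (m < 2 ^ s)%N ->
  (2 * (4 * q * s.+1 * (1 + 2 * m)) <= 2 ^ (3 * s + 4))%N.
Proof.
move=> qS mS; have sS := ltn_expl s (isT : (1 < 2)%N).
have -> : (2 ^ (3 * s + 4) = 16 * (2 ^ s * 2 ^ s * 2 ^ s))%N.
  by have -> : (3 * s + 4 = 4 + (s + s + s))%N; [lia | rewrite !expnD].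
have : (q * s.+1 * (1 + 2 * m) <= 2 ^ s * 2 ^ s * (2 * 2 ^ s))%N.
  by rewrite leq_mul // ?leq_mul //; lia.
lia.
Qed.

(** One half of the Chernoff exponent pays for the powers of [#|G|] with a factor [N^-2] to spare,
    the other half for the bits spent on each of the [m] elements. Summing over [s <= N] scales
    leaves the proportion [1/N]. *)
Lemma card_biased_small m n s (eps : R) : 0 < eps ->
  (0 < m)%N -> (m < n)%N -> (n <= 2 ^ s)%N -> (s <= #|G|)%N ->
  80 * s%:R * (4 * s%:R + 7) * ln #|G|%:R <= eps ^+ 2 * m%:R ->
  80 * s%:R * (3 * s%:R + 4) * m%:R <= eps ^+ 2 * n%:R ->
  #|G|%:R * #|biased G m n eps|%:R <= 2 ^+ #|G| :> R.
Proof.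
move=> eps0 m0 mn ns sG h1 h2.
have s0 : (0 < s)%N by case: s ns {sG h1 h2} => //; move: m0 mn; lia.
have G0 : (0 < #|G|)%N by apply: leq_trans sG.
have s0' : 0 < s%:R :> R by rewrite ltr0n.
have m0' : 0 < m%:R :> R by rewrite ltr0n.
set N : R := #|G|%:R in h1 *; have N0 : 0 < N by rewrite ltr0n.
have N1 : 1 <= N by rewrite ler1n.
set L := ln N in h1; have L0 : 0 <= L by apply: ln_ge0.
have NE : N = expR L by rewrite lnK.
have := card_biased G eps0 m0 mn ns; set b := #|biased _ _ _ _|%:R => hb.
have {}hb : b <= \sum_(j < s) 2 ^+ #|G| * expR (- (2 * L)).
  apply: (le_trans hb); rewrite big_mkcond /=; apply: ler_sum => j _.
  case: ifP => [hj|_]; last by rewrite mulr_ge0 ?expR_ge0 ?exprn_ge0.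
  rewrite mulrCA ler_wpM2l ?exprn_ge0 //.
  set q := (2 ^ j.+1)%N in hj *.
  have q1 : 1 <= q%:R :> R by rewrite ler1n expn_gt0.
  have qs : (q <= 2 ^ s)%N by rewrite leq_exp2l.
  have H : (2 * (4 * q * s.+1 * (1 + 2 * m)))%:R <= expR (3 * s%:R + 4) :> R.
    apply: le_trans (_ : (2 ^ (3 * s + 4))%:R <= _); last first.
      by apply: (le_trans (pow2_le_expR _)); rewrite natrD natrM.
    by rewrite ler_nat description_size_le // (leq_trans mn).
  set th := eps / 20 * _.
  rewrite natrM natrM !natrX -/N NE.
  rewrite -!expRM_natl.
  set A := _%:R ^+ m.
  have HA : A <= expR (m%:R * (3 * s%:R + 4)).
    by rewrite expRM_natl lerXn2r ?nnegrE ?expR_ge0 ?ler0n.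
  apply: le_trans (_ : expR ((4 * q * s.+1)%:R * L) * expR (m%:R * (3 * s%:R + 4))
     * expR (q%:R * L) * expR (- th) <= _).
    rewrite ler_wpM2r ?expR_ge0 // ler_wpM2r ?expR_ge0 // ler_wpM2l ?expR_ge0 //.
  rewrite -!expRD ler_expR.
  have -> : th = (eps ^+ 2 * m%:R / (80 * s%:R) + eps ^+ 2 * m%:R / (80 * s%:R)) * q%:R.
    by rewrite /th; field; rewrite gt_eqF.
  set e := eps ^+ 2 * m%:R / (80 * s%:R).
  (* The layer takes [4q(s + 1)] group elements, the sample [q], and the spare factor 2 more; the
     total is at most [(4s + 7) q]. *)
  have e1 : (4 * s%:R + 7) * L <= e.
    by rewrite /e ler_pdivlMr; [move: h1; lra|lra].
  have e2 : m%:R * (3 * s%:R + 4) <= e * q%:R.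
    have : n%:R <= m%:R * q%:R :> R by rewrite -natrM ler_nat.
    move=> /(ler_wpM2l (sqr_ge0 eps)) => h3.
    have -> : e * q%:R = eps ^+ 2 * (m%:R * q%:R) / (80 * s%:R) by rewrite /e; ring.
    by rewrite ler_pdivlMr; lra.
  have e3 : (4 * s%:R + 7) * L * q%:R <= e * q%:R by rewrite ler_wpM2r; lra.
  have e4 : L <= L * q%:R by rewrite ler_peMr.
  rewrite !natrM -natr1; lra.
apply: le_trans (ler_wpM2l (ltW N0) hb) _.
rewrite sumr_const card_ord -[_ *+ s]mulr_natl.
have -> : expR (- (2 * L)) = (N * N)^-1 by rewrite expRN NE mulr_natl mulr2n expRD.
have sN : s%:R <= N by rewrite ler_nat.
have -> : N * (s%:R * (2 ^+ #|G| / (N * N))) = 2 ^+ #|G| * (s%:R / N).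
  by field; rewrite gt_eqF.
by rewrite ler_piMr ?exprn_ge0 // ler_pdivrMr ?mul1r.
Qed.

End Rare.

(** * Choice of the sizes and of the number of scales *)

Section Params.
Variable R : realType.

Lemma nat_ceil (x : R) : 0 <= x -> exists k : nat, x < k%:R <= x + 1.
Proof.
move=> x0; exists (Num.truncn x).+1.
by rewrite truncnS_gt /= -natr1 lerD2r truncn_le.
Qed.

(** The single Taylor term [lam^12 / 12!] already dominates. It is used to compare [ln N] with
    powers of [ln (ln N)]. *)
Lemma expR_ge_pow10 : exists F : R, 1 <= F /\
  forall a lam : R, 1 <= a -> F * a <= lam -> a * lam ^+ 10 + 1 <= expR lam.
Proof.
have [F [F1 hF]] : exists F : R, 1 <= F /\
    forall x, 0 <= x -> 1 + x ^+ 12 / F <= expR x.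
  exists (11.+1)`!%:R; split; first by rewrite ler1n fact_gt0.
  by move=> x; apply: expR_ge1Dxn.
exists F; split=> // a lam a1 alam.
have lam1 : 1 <= lam by nra.
apply: le_trans (hF _ (le_trans ler01 lam1)).
rewrite addrC lerD2l ler_pdivlMr; last by lra.
have -> : lam ^+ 12 = lam ^+ 2 * lam ^+ 10 by rewrite -exprD.
rewrite mulrAC ler_wpM2r ?exprn_ge0 //; first by lra.
by rewrite expr2; nra.
Qed.

(* [lam] stands for ln (ln N), so [expR lam] is ln N. *)
Lemma parameters (eps : R) : 0 < eps <= 1 ->
  exists C Lam : R, forall (lam : R) (N : nat),
  Lam <= lam -> N%:R = expR (expR lam) ->
  exists m n s : nat,
    [/\ (0 < m)%N, (m < n)%N, (n <= 2 ^ s)%N & (s <= N)%N] /\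
    [/\ m%:R <= C * expR lam * lam ^+ 2,
        n%:R <= C * expR lam * lam ^+ 10,
        80 * s%:R * (4 * s%:R + 7) * expR lam <= eps ^+ 2 * m%:R &
        80 * s%:R * (3 * s%:R + 4) * m%:R <= eps ^+ 2 * n%:R].
Proof.
(* The number [s] of scales will be at most [6 lam], so [80 s (4s + 7)] is at most [14880 lam^2],
   below the 20000 used here. *)
move=> /andP[eps0 eps1]; pose C := (200 * 100) / eps ^+ 2.
have [F [F1 hF]] := expR_ge_pow10.
exists (C + 1), (F * (C + 1)) => lam N Clam NE.
have e2 : 0 < eps ^+ 2 <= 1 by rewrite exprn_gt0 //= expr_le1 // ltW.
have CE : C * eps ^+ 2 = (200 * 100) by rewrite /C divfK // gt_eqF; case/andP: e2.
have C1 : (200 * 100) <= C by rewrite /C ler_pdivlMr; [nra | case/andP: e2].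
have := hF (C + 1) lam; set L := expR lam => /(_ ltac:(lra) Clam) Lbig.
have lamC : C + 1 <= lam by nra.
have lam2 : lam <= lam ^+ 2 by rewrite expr2; nra.
have lam6 : lam <= lam ^+ 6 by rewrite -[leLHS]expr1 ler_eXn2l //; lra.
have lam10 : lam ^+ 10 = lam ^+ 6 * (lam ^+ 2 * lam ^+ 2) by rewrite -!exprD.
have lam11 : 1 <= lam ^+ 10 by rewrite exprn_ege1 //; lra.
have L1 : 1 <= L by nra.
have lam0 : 0 <= lam by lra.
have CL0 : 0 <= C * L by apply: mulr_ge0; lra.
have [m /andP[m1 m2]] := nat_ceil (mulr_ge0 CL0 (exprn_ge0 2 lam0)).
have [n /andP[n1 n2]] := nat_ceil (mulr_ge0 CL0 (exprn_ge0 10 lam0)).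
(* With [s = 2 s'] and [s' > 2 lam], [2^s = 4^s' >= e^(2 lam) = L^2], which exceeds [n]. *)
have [s' /andP[s1 s2]] := @nat_ceil (2 * lam) ltac:(lra).
set p2 := lam ^+ 2 in lam2 lam10 m1 m2 *; set p6 := lam ^+ 6 in lam6 lam10.
have Lp2 : 1 <= L * p2 by nra.
have Lp10 : 1 <= L * lam ^+ 10 by nra.
have sE : (2 * s')%:R = 2 * s'%:R :> R by rewrite natrM.
have s6 : (2 * s')%:R <= 6 * lam :> R by rewrite sE; lra.
exists m, n, (2 * s')%N; split; split.
- by rewrite -(ltr_nat R); apply: lt_trans m1; nra.
- rewrite -(ltr_nat R); apply: le_lt_trans m2 _; apply: le_lt_trans n1.
  rewrite lam10; have : 2 <= p6 * p2 by nra.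
  have : 1 <= C * L * p2 by nra.
  set u := C * L * p2; have -> : C * L * (p6 * (p2 * p2)) = u * (p6 * p2) by rewrite /u; ring.
  by nra.
- rewrite -(ler_nat R); apply: le_trans n2 _.
  have : L ^+ 2 <= (2 ^ (2 * s'))%:R.
    rewrite expnM natrX; apply: le_trans (_ : expR 1 ^+ s' <= _); last first.
      by rewrite lerXn2r ?nnegrE ?expR_ge0 // expR1_le4.
    by rewrite -!expRM_natl mulr1 ler_expR; lra.
  apply: le_trans; rewrite expr2; nra.
- rewrite -(ler_nat R) NE; have := @expR_ge1Dx R L; apply: le_trans.
  apply: (le_trans s6); suff : 6 * lam <= (C + 1) * lam ^+ 10 by lra.
  by rewrite ler_pM //; [lra | rewrite -[leLHS]expr1 ler_eXn2l //; lra].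
- by move: m2; nra.
- by move: n2; nra.
- set S := (2 * s')%:R in s6 *; have S0 : 0 <= S by rewrite ler0n.
  have : 80 * S * (4 * S + 7) <= (200 * 100) * p2 by rewrite /p2 expr2; nra.
  move=> h; apply: (@le_trans _ _ ((200 * 100) * p2 * L)); first by rewrite ler_wpM2r //; lra.
  apply: le_trans (ler_wpM2l (_ : 0 <= eps ^+ 2) (ltW m1)); last by case/andP: e2 => /ltW.
  by rewrite -CE le_eqVlt; apply/orP; left; apply/eqP; ring.
- set S := (2 * s')%:R in s6 *; have S0 : 0 <= S by rewrite ler0n.
  have : 80 * S * (3 * S + 4) <= (110 * 100) * p2 by rewrite /p2 expr2; nra.
  move=> h; apply: (@le_trans _ _ ((110 * 100) * p2 * m%:R)); first by rewrite ler_wpM2r ?ler0n.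
  apply: (@le_trans _ _ ((110 * 100) * p2 * ((C + 1) * (L * p2)))).
    by rewrite ler_wpM2l //; nra.
  apply: le_trans (ler_wpM2l (_ : 0 <= eps ^+ 2) (ltW n1)); last by case/andP: e2 => /ltW.
  have -> : eps ^+ 2 * (C * L * lam ^+ 10) = (200 * 100) * (p2 * (L * p2)) * p6.
    by rewrite -CE lam10; ring.
  have -> : (110 * 100) * p2 * ((C + 1) * (L * p2)) = (110 * 100) * (p2 * (L * p2)) * (C + 1) by ring.
  have : 0 <= p2 * (L * p2) by nra.
  move: (p2 * (L * p2)) => u u0; nra.
Qed.

End Params.

(** * Two-sided regularity of the sum counts *)

Section Regular.
Variables (R : realType) (G : finZmodType).
Implicit Types (X Y B : {set G}).

Lemma biasC B X Y : bias R (~: B) X Y = - bias R B X Y.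
Proof.
rewrite /bias -sumrN; apply: eq_bigr => x _; rewrite -sumrN.
by apply: eq_bigr => y _; rewrite /signed inE; case: (_ \in B); rewrite ?opprK.
Qed.

Lemma sum_mem_bias B X Y :
  \sum_(x in X) \sum_(y in Y) (x + y \in B)%:R
    = (bias R B X Y + #|X|%:R * #|Y|%:R) / 2 :> R.
Proof.
have -> : #|X|%:R * #|Y|%:R = \sum_(x in X) \sum_(y in Y) (1 : R).
  by rewrite !sumr_const mulr_natl.
rewrite /bias -big_split mulr_suml; apply: eq_bigr => x _.
rewrite -big_split mulr_suml; apply: eq_bigr => y _ /=.
by rewrite /signed; case: (_ \in B) => /=; lra.
Qed.

(** Complementing [B] changes the sign of its bias, so one-sided bounds for [B] and its complement
    give a two-sided one. *)
Definition balanced (m n : nat) (eps : R) : {set {set G}} :=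
  [set B in ~: biased G m n eps | ~: B \notin biased G m n eps].

Lemma balanced_regular B (m n : nat) (eps : R) X Y :
  (0 < m <= #|X|)%N -> (0 < n <= #|Y|)%N -> 0 <= eps ->
  B \in balanced m n eps ->
  `| \sum_(x in X) \sum_(y in Y) (x + y \in B)%:R - 2^-1 * #|X|%:R * #|Y|%:R |
    <= eps * (#|X|%:R * #|Y|%:R).
Proof.
rewrite 2!inE => mX nY eps0.
move=> /andP[/(unbiased_large mX nY) h1 /(unbiased_large mX nY)].
rewrite biasC sum_mem_bias => h2; rewrite ler_norml.
have : 0 <= #|X|%:R * #|Y|%:R :> R by rewrite mulr_ge0.
move: h1 h2; rewrite -mulrA; move: (#|X|%:R * #|Y|%:R) (bias _ _ _ _) => p b.
by move=> h1 h2 p0; have := mulr_ge0 eps0 p0; move=> h3; apply/andP; split; lra.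
Qed.

Lemma card_balanced m n (eps b : R) :
  #|biased G m n eps|%:R <= b ->
  2 ^+ #|G| - 2 * b <= #|balanced m n eps|%:R.
Proof.
rewrite /balanced; set F := biased G m n eps => Fb.
have cF : #|[set B | ~: B \in F]| = #|F|.
  rewrite -(card_imset F (can_inj (@finset.setCK G))); apply: eq_card => B.
  rewrite inE; apply/idP/imsetP => [h|[C CF ->]]; last by rewrite finset.setCK.
  by exists (~: B); rewrite ?finset.setCK.
have -> : [set B in ~: F | ~: B \notin F] = ~: (F :|: [set B | ~: B \in F]).
  by apply/setP => B; rewrite !inE negb_or.
have := cardsC (F :|: [set B | ~: B \in F]).
rewrite -cardsT -powersetT card_powerset cardsT => h.
have := leq_of_leqif (leq_card_setU F [set B | ~: B \in F]); rewrite cF => hU.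
have : 2 ^+ #|G| = #|F :|: [set B | ~: B \in F]|%:R
    + #|~: (F :|: [set B | ~: B \in F])|%:R :> R.
  by rewrite -natrD h natrX.
move: hU; rewrite -(ler_nat R) natrD; lra.
Qed.

End Regular.

Local Open Scope classical_set_scope.
Local Open Scope ring_scope.

(** * Uniform law of the random subset *)

Section Uniform.
Variables (d : measure_display) (T : measurableType d) (R : realType).
Variables (P : probability T R) (G : finType) (A : T -> {set G}).
Hypothesis hA : half_random_subset P A.

Let cylinder (J K : {set G}) : set T :=
  [set t | J \subset A t /\ K \subset ~: A t].

(** Independence is given for membership events; avoidance of [K] is added point by point, by
    subtracting the event in which that point is moved from [K] to [J]. *)
Let cylinderP (J K : {set G}) : K \subset ~: J ->
  measurable (cylinder J K) /\ P (cylinder J K) = (2^-1 ^+ (#|J| + #|K|))%:E.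
Proof.
have [mA pA indep] := hA.
have [k] := ubnP #|K|; elim: k J K => // k IH J K; rewrite ltnS => Kk KJ.
have [K0|[x xK]] := set_0Vmem K.
  have -> : cylinder J K = \bigcap_(i in [set` J]) [set t | i \in A t].
    apply/seteqP; split=> t /=.
      by move=> [/fintype.subsetP JA _] i /= /JA.
    move=> h; split; last by rewrite K0 sub0set.
    by apply/fintype.subsetP => i iJ; apply: h.
  split; first by apply: fin_bigcap_measurable => //.
  rewrite indep (eq_bigr (fun=> (2^-1)%:E)); last by move=> i _; apply: pA.
  rewrite K0 cards0 addn0 prodEFin.
  by rewrite prodr_const.
have [mJK pJK] : measurable (cylinder J (K :\ x)) /\
    P (cylinder J (K :\ x)) = (2^-1 ^+ (#|J| + #|K :\ x|))%:E.
  apply: IH; first by move: Kk; rewrite (cardsD1 x K) xK.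
  by apply: fintype.subset_trans KJ; apply: subsetDl.
have xJ : x \notin J by have := fintype.subsetP KJ _ xK; rewrite inE.
have [mxJ pxJ] : measurable (cylinder (x |: J) (K :\ x)) /\
    P (cylinder (x |: J) (K :\ x)) = (2^-1 ^+ (#|x |: J| + #|K :\ x|))%:E.
  apply: IH; first by move: Kk; rewrite (cardsD1 x K) xK.
  apply/fintype.subsetP => y; rewrite !inE negb_or => /andP[-> yK] /=.
  by have := fintype.subsetP KJ _ yK; rewrite inE.
have eI : cylinder J (K :\ x) `&` [set t | x \in A t] = cylinder (x |: J) (K :\ x).
  apply/seteqP; split=> t /=.
    by move=> [[JA KA] xA]; split; rewrite // subUset sub1set xA.
  by move=> [+ KA]; rewrite subUset sub1set => /andP[xA JA].
have eD : cylinder J (K :\ x) `\` [set t | x \in A t] = cylinder J K.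
  apply/seteqP; split=> t /=.
    move=> [[JA KA] /negP xA]; split; rewrite // -(setD1K xK) subUset sub1set.
    by rewrite inE xA.
  move=> [JA KA]; split; last first.
    by apply/negP; have := fintype.subsetP KA _ xK; rewrite inE.
  by split=> //; apply: fintype.subset_trans KA; apply: subsetDl.
have mD := measurableD mJK (mA x); rewrite eD in mD.
split=> //.
have : P (cylinder J (K :\ x))
    = (P (cylinder J K) + P (cylinder (x |: J) (K :\ x)))%E.
  by rewrite -eI -eD; apply: measureDI.
rewrite pJK pxJ cardsU1 xJ (cardsD1 x K) xK.
have := fin_num_measure P _ mD; case: (P _) => // r _ /=.
rewrite -EFinD => -[h]; congr _%:E.
move: h; rewrite !exprD !expr1 /= => h; lra.
Qed.

(** The cylinders with [K] the complement of [J] fix [A t] completely and have equal mass, so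
    probabilities become counts. *)
Lemma uniform_law (F : {set {set G}}) :
  measurable [set t | A t \in F] /\
  P [set t | A t \in F] = (#|F|%:R / 2 ^+ #|G|)%:E.
Proof.
have [k] := ubnP #|F|; elim: k F => // k IH F; rewrite ltnS => Fk.
have [->|[B BF]] := set_0Vmem F.
  rewrite cards0 mul0r (_ : [set t | _] = classical_sets.set0) ?measure0; last first.
    by apply/seteqP; split=> t //=; rewrite inE.
  by split.
have [|mF pF] := IH (F :\ B); first by move: Fk; rewrite (cardsD1 B F) BF.
have [mB pB] : measurable (cylinder B (~: B)) /\ P (cylinder B (~: B)) = (2^-1 ^+ #|G|)%:E.
  have [] := @cylinderP B (~: B); first exact: fintype.subxx.
  by rewrite cardsC.
have cB t : cylinder B (~: B) t <-> A t = B.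
  split=> [[BA]|AB]; last by split; rewrite AB.
  by rewrite finset.setCS => AB; apply/eqP; rewrite finset.eqEsubset AB.
have -> : [set t | A t \in F] = cylinder B (~: B) `|` [set t | A t \in F :\ B].
  apply/seteqP; split=> t /=.
    by have [/cB ?|nB tF] := eqVneq (A t) B; [left | right; rewrite !inE nB].
  by move=> [/cB -> //|]; rewrite inE => /andP[].
split; first exact: measurableU.
have -> : P (cylinder B (~: B) `|` [set t | A t \in F :\ B])
    = (P (cylinder B (~: B)) + P [set t | A t \in F :\ B])%E.
  apply: measureU => //; apply/seteqP; split=> t //= [/cB ->].
  by rewrite !inE eqxx.
by rewrite pB pF -EFinD (cardsD1 B F) BF natrD mulrDl mul1r exprVn.
Qed.

End Uniform.

(** * Diagonal choice of a rate *)

Section Diagonal.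
Variable R : realType.

Lemma diagonal (Q : R -> nat -> Prop) : (forall N, Q 1 N) ->
  (forall e, 0 < e <= 1 -> exists N0, forall N, (N0 <= N)%N -> Q e N) ->
  exists e : nat -> R, e n @[n --> \oo] --> (0 : R) /\ forall N, Q (e N) N.
Proof.
move=> Q1 Qev.
have /choice[f hf] : forall k : nat, exists N0, forall N, (N0 <= N)%N -> Q (k.+1%:R^-1) N.
  by move=> k; apply: Qev; rewrite invr_gt0 ltr0n /= invf_le1 ?ltr0n // ler1n.
have /choice[e he] : forall N, exists e : R, [/\ 0 <= e, Q e N &
    forall k, (k <= N)%N -> (f k <= N)%N -> e <= k.+1%:R^-1].
  (* The largest such [k] gives the rate [1 / (k + 1)]; [k <= N] makes it exist, and [k = 0] is
     always allowed because [Q 1] holds everywhere. *)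
  move=> N; pose p k := (k <= N)%N && ((k == 0)%N || (f k <= N)%N).
  have p0 : exists k, p k by exists 0%N.
  have pN k : p k -> (k <= N)%N by case/andP.
  case: (ex_maxnP p0 pN) => k /andP[kN kf] kmax.
  exists k.+1%:R^-1; split; first by rewrite invr_ge0.
    case/orP: kf => [/eqP->|/hf //]; by rewrite invr1.
  move=> j jN jf; rewrite lef_pV2 ?posrE ?ltr0n // ler_nat ltnS.
  by apply: kmax; rewrite /p jN jf orbT.
exists e; split; last by move=> N; have [] := he N.
apply/cvgr0Pnorm_le => eps eps0.
have [k _ hk] := near_infty_natSinv_lt (PosNum eps0).
exists (maxn k (f k)) => // N /=; rewrite geq_max => /andP[kN fN].
have [e0 _ /(_ k kN fN) ek] := he N; rewrite ger0_norm //.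
by apply: (le_trans ek); apply/ltW/hk => /=.
Qed.

End Diagonal.

(** * High-probability regularity in large groups *)

Section Likely.
Variables (R : realType) (w : nat -> R).

(** One [eps] bounds both the failure probability and the relative error; quantifying over all
    groups of order [n] makes the rate uniform in the group. *)
Definition likely (eps : R) (n : nat) : Prop :=
  forall (G : finZmodType) (d : measure_display) (T : measurableType d)
    (P : probability T R) (A : T -> {set G}),
    half_random_subset P A -> #|G| = n ->
    ((1 - eps)%:E <= P [set t | (forall X Y : {set G},
      w n * ln n%:R * ln (ln n%:R) ^+ 2 <= #|X|%:R ->
      w n * ln n%:R * ln (ln n%:R) ^+ 10 <= #|Y|%:R ->
      `| \sum_(x in X) \sum_(y in Y) (x + y \in A t)%:R
         - 2^-1 * #|X|%:R * #|Y|%:R | <= eps * (#|X|%:R * #|Y|%:R))%R ])%E.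

Lemma likely1 n : likely 1 n.
Proof. by move=> G d T P A _ _; rewrite subrr; apply: measure_ge0. Qed.

Lemma likely_eventually (w_infty : w n @[n --> \oo] --> +oo) (eps : R) :
  0 < eps <= 1 -> exists n0, forall n, (n0 <= n)%N -> likely eps n.
Proof.
move=> /[dup] eps01 /andP[eps0 eps1].
have [C [Lam hpar]] := parameters eps01.
have /cvgryPge /(_ C) [n1 _ hw] := w_infty.
pose K : R := Num.max 1 Lam.
have [n2 /andP[n2K _]] := nat_ceil (expR_ge0 (expR K)).
have [n3 /andP[n3e _]] : exists k : nat, 2 / eps < k%:R <= 2 / eps + 1.
  by apply: nat_ceil; rewrite divr_ge0 // ltW.
(* These bounds give [w N >= C], [ln (ln N) >= K] and [2 / N <= eps], the last for the two families
   of proportion at most [1 / N] that [balanced] excludes. *)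
exists (maxn n1 (maxn n2 n3)) => N; rewrite !geq_max => /and3P[Nn1 Nn2 Nn3].
move=> G d T P A hA GN; set L := ln N%:R; set good := [set t | _].
have NK : expR (expR K) <= N%:R.
  by apply: (le_trans (ltW n2K)); rewrite ler_nat.
have N0 : 0 < N%:R :> R by apply: lt_le_trans NK; apply: expR_gt0.
have LK : expR K <= L by rewrite -ler_expR lnK.
have L0 : 0 < L by apply: lt_le_trans LK; apply: expR_gt0.
have lamK : K <= ln L by rewrite -ler_expR lnK.
have lamLam : Lam <= ln L by apply: le_trans lamK; rewrite le_max lexx orbT.
have lam0 : 0 <= ln L.
  by apply: le_trans lamK; rewrite (le_trans ler01) // le_max lexx.
have NE : N%:R = expR (expR (ln L)) :> R by rewrite lnK // /L lnK.
have [m [n [s [[m0 mn ns sN] [mC nC h1 h2]]]]] := hpar _ _ lamLam NE.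
rewrite lnK // in mC nC h1.
have small : #|G|%:R * #|biased G m n eps|%:R <= 2 ^+ #|G| :> R.
  by apply: (card_biased_small eps0 m0 mn ns); rewrite ?GN.
have {}small : #|biased G m n eps|%:R <= 2 ^+ #|G| * N%:R^-1 :> R.
  by rewrite ler_pdivlMr // mulrC -GN.
have bad := card_balanced small.
pose regular : {set {set G}} := finset (fun B : {set G} => `[< forall X Y : {set G},
      w N * L * ln L ^+ 2 <= #|X|%:R -> w N * L * ln L ^+ 10 <= #|Y|%:R ->
      `| \sum_(x in X) \sum_(y in Y) (x + y \in B)%:R
         - 2^-1 * #|X|%:R * #|Y|%:R | <= eps * (#|X|%:R * #|Y|%:R) >]).
have wC : C <= w N by apply: hw.
have sub : balanced G m n eps \subset regular.
  apply/fintype.subsetP => B Bb; rewrite inE.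
  apply/asboolP => X Y hX hY; apply: (@balanced_regular _ _ _ m n) => //.
  - rewrite m0 -(ler_nat R) (le_trans mC) // (le_trans _ hX) //.
    by rewrite ler_wpM2r ?exprn_ge0 // ler_wpM2r // ltW.
  - rewrite (leq_trans m0 (ltnW mn)) -(ler_nat R) (le_trans nC) // (le_trans _ hY) //.
    by rewrite ler_wpM2r ?exprn_ge0 // ler_wpM2r // ltW.
  - exact: ltW.
(* The event depends on [A t] only, so the uniform law turns its probability into a count. *)
have -> : good = [set t | A t \in regular].
  apply/seteqP; split=> t /=; rewrite inE.
    by move=> h; apply/asboolP.
  by move=> /asboolP.
have [_ ->] := uniform_law hA regular.
rewrite lee_fin ler_pdivlMr ?exprn_gt0 //.
have := subset_leq_card sub; rewrite -(ler_nat R); apply: le_trans.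
apply: le_trans bad; rewrite mulrBl mul1r lerD2l lerN2 mulrCA mulrC.
rewrite ler_wpM2r ?exprn_ge0 // ler_pdivrMr // mulrC -ler_pdivrMr //.
by rewrite (le_trans (ltW n3e)) // ler_nat.
Qed.

End Likely.

Theorem theorem2 (R : realType) (w : nat -> R)
    (w_growing : forall m n : nat, (m <= n)%N -> w m <= w n)
    (w_infty : w n @[n --> \oo] --> +oo) :
  exists delta eps : nat -> R,
    [/\ delta n @[n --> \oo] --> (0 : R),
        eps n @[n --> \oo] --> (0 : R)
      & forall (G : finZmodType) (d : measure_display) (T : measurableType d)
          (P : probability T R) (A : T -> {set G}),
          half_random_subset P A ->
          let N := #|G| in
          let L : R := ln N%:R in
          let good : set T :=
            [set t | forall X Y : {set G},
               w N * L * ln L ^+ 2 <= #|X|%:R ->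
               w N * L * ln L ^+ 10 <= #|Y|%:R ->
               `| \sum_(x in X) \sum_(y in Y) (x + y \in A t)%:R
                  - 2^-1 * #|X|%:R * #|Y|%:R |
               <= eps N * (#|X|%:R * #|Y|%:R) ] in
          ((1 - delta N)%:E <= P good)%E].
Proof.
have [e [e0 elikely]] := diagonal (likely1 w) (likely_eventually w_infty).
(* The diagonal sequence serves both as failure probability and as error rate. *)
exists e, e; split=> // G d T P A hA.
exact: elikely hA (erefl _).
Qed.
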